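(* Let $\Omega\subset\mathbb{R}^2$ be a bounded domain, and let $r>0$ be such that $|\Omega|\ge \pi r^2$. Set $\Omega_r=\Omega\cup\left[\bigcup_{x\in\partial\Omega}D_r(x)\right]$. If for a point $x_0\in\Omega$ and some $\mu>0$ the weighted mean value identity $$a(\mu r)\, v(x_0)=\frac{1}{|\Omega|}\int_\Omega v(y)\log\frac{r}{|x_0-y|}\,dy$$ holds for every positive function $v$ satisfying the equation $\nabla^2 v-\mu^2 v=0$ in $\Omega_r$, then $\Omega=D_r(x_0)$.
   Context: $D_r(x)=\{y\in\mathbb{R}^2:|y-x|<r\}$ is the open disc of radius $r$ centred at $x$; $|\Omega|$ is the area (Lebesgue measure) of $\Omega$; $\nabla^2=\partial^2/\partial x_1^2+\partial^2/\partial x_2^2$; solutions are real-valued. The function $a$ is $a(t)=2\,[I_0(t)-1]/t^2$ for $t>0$, where $I_0$ is the modified Bessel function of the first kind of order $0$.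
   Formalization: As stated this fails for a disc punctured at a point other than x_0; the formal conclusion is Ω ⊂ D_r(x_0) with |D_r(x_0) \ Ω| = 0, and Ω = D_r(x_0) whenever Ω equals the interior of its closure. *)

(* Defs.v *)
(* MathComp-Analysis, over an arbitrary R : realType; the plane is R * R. *)
From HB Require Import structures.
From mathcomp Require Import all_boot all_order all_algebra.
From mathcomp Require Import all_classical all_reals all_analysis.

Set Implicit Arguments.
Unset Strict Implicit.
Unset Printing Implicit Defensive.

Import Order.TTheory GRing.Theory Num.Theory.
Import numFieldNormedType.Exports.

Local Open Scope classical_set_scope.
Local Open Scope ring_scope.

(* The library norm on R * R is the sup norm. It induces the usual topology, so
   it is harmless for open, connected, bounded, closure and derivatives, but
   discs and |x - y| need the Euclidean distance. *)
Definition dist2 (R : realType) (x y : R * R) : R :=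
  Num.sqrt ((x.1 - y.1) ^+ 2 + (x.2 - y.2) ^+ 2).

Definition disc (R : realType) (x : R * R) (r : R) : set (R * R) :=
  [set y | dist2 y x < r].

Definition boundary (T : topologicalType) (A : set T) : set T :=
  closure A `\` interior A.

Definition disc_nbhd (R : realType) (A : set (R * R)) (r : R) : set (R * R) :=
  A `|` \bigcup_(x in boundary A) disc x r.

Definition area (R : realType) :=
  ((@lebesgue_measure R) \x (@lebesgue_measure R))%E.
Arguments area R : clear implicits.

Definition bounded_domain (R : realType) (A : set (R * R)) : Prop :=
  [/\ A !=set0, open A, connected A & bounded_set A].

Definition e1 (R : realType) : R * R := (1, 0).
Definition e2 (R : realType) : R * R := (0, 1).

Definition pd1 (R : realType) (v : R * R -> R) : R * R -> R :=
  fun x => 'D_(e1 R) v x.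
Definition pd2 (R : realType) (v : R * R -> R) : R * R -> R :=
  fun x => 'D_(e2 R) v x.

(* 'D_e v x has a default value where the limit does not exist, hence the
   separate derivability clauses. *)
Definition C1_on (R : realType) (U : set (R * R)) (v : R * R -> R) : Prop :=
  forall x, U x ->
    [/\ derivable v x (e1 R), derivable v x (e2 R),
        {for x, continuous (pd1 v)} & {for x, continuous (pd2 v)}].

Definition C2_on (R : realType) (U : set (R * R)) (v : R * R -> R) : Prop :=
  [/\ C1_on U v, C1_on U (pd1 v) & C1_on U (pd2 v)].

Definition laplacian (R : realType) (v : R * R -> R) : R * R -> R :=
  fun x => pd1 (pd1 v) x + pd2 (pd2 v) x.

(* Classical solutions of the modified Helmholtz equation; the values of v
   outside the open set U are irrelevant. *)
Definition mod_helmholtz (R : realType) (mu : R) (U : set (R * R))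
    (v : R * R -> R) : Prop :=
  C2_on U v /\ forall x, U x -> laplacian v x - mu ^+ 2 * v x = 0.

Definition besselI0 (R : realType) (t : R) : R :=
  limn (series (fun k : nat => (t / 2) ^+ k.*2 / (k`!%:R) ^+ 2)).

(* Only used for t > 0. *)
Definition coef_a (R : realType) (t : R) : R :=
  2 * (besselI0 t - 1) / t ^+ 2.

(* Main.v *)
Require Import Defs.
From HB Require Import structures.
From mathcomp Require Import all_boot all_order all_algebra.
From mathcomp Require Import all_classical all_reals all_analysis.
From mathcomp Require Import measurable_realfun ring lra.

Set Implicit Arguments.
Unset Strict Implicit.
Unset Printing Implicit Defensive.

Import Order.TTheory GRing.Theory Num.Theory.
Import numFieldNormedType.Exports.

Local Open Scope classical_set_scope.
Local Open Scope ring_scope.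

(** The identity is tested on one function only, the radial solution
    v(y) = I_0(mu |y - x0|).  It is positive on the whole plane, satisfies the
    modified Helmholtz equation everywhere and equals 1 at x0.  Let D be the
    closed disc of radius r centred at x0, and let
    f(y) = v(y) log (r / |x0 - y|) be the integrand of the identity: f is
    nonnegative on D, positive inside D away from x0, and negative outside D.

    On D itself the weighted mean value identity holds by computation
    (integral_bessel_log_disc): with a = coef_a (mu r), the integral of f over D
    is a pi r^2.  Subtracting from this the assumed identity, which says that
    the integral of f over Omega is a |Omega|, the contribution of the common
    part of D and Omega cancels and
<<
      a (|Omega| - pi r^2) = int_(Omega \ D) f - int_(D \ Omega) f.
>>
    The left side is nonnegative since a > 0 and |Omega| >= pi r^2, the right
    side is nonpositive by the signs of f, so both integrals on the right
    vanish.  As x0 belongs to Omega, the only zeros of f in D \ Omega lie on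
    the circle bounding D, and f has no zero in Omega \ D; hence Omega \ D and
    the part of D \ Omega inside the circle are null
    (Rintegral_eq0_null).  The open null set Omega \ D is empty
    (open_null_eq0), and an open set contained in D avoids the circle
    (open_sub_closed_disc), whence the first two conclusions.  If moreover
    Omega is regular open, the open null set disc \ closure Omega is empty, so
    that the disc lies in the interior of closure Omega, which is Omega.

    Everything radial is written in terms of s = |y - x0|^2 instead of the
    distance.  With c = mu^2 / 4, I_0(mu sqrt s) is the entire function
    J(s) = sum_k (c s)^k / k!^2, so no square root has to be differentiated,
    and Bessel's equation becomes s J'' + J' = c J (bessel_ode).  The squared
    distance pushes the area forward to pi times the length of the half line
    (area_sqdist_preimage), which stands in for polar coordinates, and the
    equation provides the antiderivative (s J' log (b / s) + J) / (2 c) of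
    J log (b / s) / 2, which gives the integral over D. *)

(** * The Bessel function in terms of the squared radius *)

Section BesselSeries.
Context {R : realType}.
Implicit Types (c s : R) (m k : nat).

(** The coefficients of the m-th derivative of J(s) = I_0(2 sqrt (c s)): keeping
    m as a parameter makes the family stable under differentiation. *)
Definition bessel_coef c m k : R := c ^+ (k + m) / (k`!%:R * (k + m)`!%:R).

Definition bessel_fun c m s : R := limn (pseries (bessel_coef c m) s).

Lemma bessel_coef_ge0 c m k : 0 <= c -> 0 <= bessel_coef c m k.
Proof. by move=> c0; rewrite divr_ge0 ?exprn_ge0 ?mulr_ge0. Qed.

Lemma is_cvg_bessel c m s : cvgn (pseries (bessel_coef c m) s).
Proof.
apply: normed_cvg.
apply: (@series_le_cvg _ _ (fun k => `|c| ^+ m * exp_coeff `|c * s| k)).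
- by move=> k; exact: normr_ge0.
- by move=> k; rewrite mulr_ge0 ?exprn_ge0 ?exp_coeff_ge0.
- move=> k; rewrite /bessel_coef /exp_coeff /=.
  rewrite !normrM normrV ?unitfE ?mulf_neq0 ?pnatr_eq0 -?lt0n ?fact_gt0//.
  rewrite !normrX !normrM !normr_nat exprMn exprD invfM.
  have -> : `|c| ^+ k * `|c| ^+ m * (k`!%:R^-1 * (k + m)`!%:R^-1) * `|s| ^+ k
    = (`|c| ^+ m * (`|c| ^+ k * `|s| ^+ k / k`!%:R)) * (k + m)`!%:R^-1 by ring.
  rewrite ler_piMr ?mulr_ge0 ?exprn_ge0 ?invr_ge0 ?ler0n//.
  by rewrite invf_le1 ?ltr0n ?ler1n fact_gt0.
- rewrite (_ : (fun k => _) = `|c| ^+ m *: exp_coeff `|c * s|)//.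
  by apply: is_cvg_seriesZ; exact: is_cvg_series_exp_coeff.
Qed.

Lemma bessel_diffs c m : pseries_diffs (bessel_coef c m) = bessel_coef c m.+1.
Proof.
apply/funext => k; rewrite /pseries_diffs /bessel_coef addSnnS factS natrM.
have k0 : k.+1%:R != 0 :> R by rewrite pnatr_eq0.
have f0 n : n`!%:R != 0 :> R by rewrite pnatr_eq0 -lt0n fact_gt0.
move: (k.+1%:R) (k`!%:R) ((k + m.+1)`!%:R) k0 (f0 k) (f0 (k + m.+1)%N).
by move=> a b d a0 b0 d0; field; rewrite d0 b0.
Qed.

Lemma is_derive_bessel c m s :
  is_derive s (1 : R) (bessel_fun c m) (bessel_fun c m.+1 s).
Proof.
rewrite /bessel_fun -bessel_diffs.
apply: (@pseries_snd_diffs _ _ (`|s| + 1)); rewrite ?bessel_diffs;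
  try exact: is_cvg_bessel.
by rewrite [ltRHS]ger0_norm ?addr_ge0// ltrDl.
Qed.

Lemma continuous_bessel c m : continuous (bessel_fun c m).
Proof.
move=> s; apply/differentiable_continuous/derivable1_diffP.
by have [] := is_derive_bessel c m s.
Qed.

(** Bessel's equation s J'' + J' = c J, read off coefficient by coefficient:
    the k-th coefficient c_k of J' satisfies k c_k + c_k = c times the k-th
    coefficient of J. *)
Lemma bessel_ode c s :
  s * bessel_fun c 2 s + bessel_fun c 1 s = c * bessel_fun c 0 s.
Proof.
have cv2 : [series i%:R * bessel_coef c 1 i * s ^+ i.-1]_i @ \oo -->
    bessel_fun c 2 s.
  rewrite /bessel_fun -(bessel_diffs c 1); apply: pseries_diffs_equiv.
  by rewrite bessel_diffs; exact: is_cvg_bessel.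
have cv1 : pseries (bessel_coef c 1) s @ \oo --> bessel_fun c 1 s.
  exact: is_cvg_bessel.
have cv0 : pseries (bessel_coef c 0) s @ \oo --> bessel_fun c 0 s.
  exact: is_cvg_bessel.
have cvR : c * pseries (bessel_coef c 0) s n @[n --> \oo] -->
    c * bessel_fun c 0 s by exact: cvgMr.
apply: (cvg_unique _ _ cvR) => //.
rewrite (_ : (fun n => _) = fun n =>
  s * [series i%:R * bessel_coef c 1 i * s ^+ i.-1]_i n +
  pseries (bessel_coef c 1) s n).
  by apply: cvgD => //; exact: cvgMr.
apply/funext => n; rewrite /pseries /series /= !big_distrr/= -big_split/=.
apply: eq_bigr => k _.
rewrite /bessel_coef addn0 addn1 factS natrM.
have k0 : k.+1%:R != 0 :> R by rewrite pnatr_eq0.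
have f0 : k`!%:R != 0 :> R by rewrite pnatr_eq0 -lt0n fact_gt0.
case: k k0 f0 => [|k] k0 f0.
  by rewrite !expr0 expr1 fact0; field.
rewrite /= !exprS -[k.+2]addn1 natrD; rewrite -addn1 natrD in k0.
move: (k.+1%:R) (k.+1`!%:R) k0 f0 => a b a0 b0.
by field; rewrite b0 a0.
Qed.

(** For nonnegative arguments all terms are nonnegative, so partial sums bound
    the sum from below; one or two terms are enough for the bounds needed. *)
Lemma bessel_sum_le c s n : 0 <= c -> 0 <= s ->
  pseries (bessel_coef c 0) s n <= bessel_fun c 0 s.
Proof.
move=> c0 s0; apply: nondecreasing_cvgn_le; last exact: is_cvg_bessel.
apply/nondecreasing_seqP => m.
rewrite /pseries /series /= big_nat_recr//= lerDl.
by rewrite mulr_ge0 ?bessel_coef_ge0 ?exprn_ge0.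
Qed.

Lemma bessel_fun0 c : bessel_fun c 0 0 = 1.
Proof.
apply/cvg_lim => //; apply: cvg_near_cst; near=> n.
have n0 : (0 < n)%N by near: n; exact: nbhs_infty_gt.
rewrite -(prednK n0) /pseries /series /= big_nat_recl//= big1.
  by rewrite /bessel_coef !expr0 fact0 !mulr1 divr1 addr0.
by move=> k _; rewrite exprS mul0r mulr0.
Unshelve. all: by end_near. Qed.

Lemma bessel_ge1 c s : 0 <= c -> 0 <= s -> 1 <= bessel_fun c 0 s.
Proof.
move=> c0 s0; apply: le_trans (bessel_sum_le 1 c0 s0).
rewrite /pseries /series /= big_nat1 /bessel_coef.
by rewrite !expr0 fact0 !mulr1 divr1.
Qed.

Lemma bessel_gt1 c s : 0 < c -> 0 < s -> 1 < bessel_fun c 0 s.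
Proof.
move=> c0 s0; apply: lt_le_trans (bessel_sum_le 2 (ltW c0) (ltW s0)).
rewrite /pseries /series /= big_nat_recr//= big_nat1 /bessel_coef.
rewrite !expr0 fact0 !mulr1 divr1 ltrDl.
by rewrite mulr_gt0 ?divr_gt0 ?exprn_gt0 ?mulr_gt0 ?ltr0n ?fact_gt0.
Qed.

Lemma besselI0E mu r : besselI0 (mu * r) = bessel_fun (mu ^+ 2 / 4) 0 (r ^+ 2).
Proof.
rewrite /besselI0 /bessel_fun; congr (limn (series _)); apply/funext => k /=.
rewrite /bessel_coef addn0 -mul2n exprM -expr2.
have -> : (mu * r / 2) ^+ 2 = mu ^+ 2 / 4 * r ^+ 2 by field.
by rewrite exprMn mulrAC.
Qed.

End BesselSeries.

(** * A positive radial solution of the modified Helmholtz equation *)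

Section PartialDerivatives.
Context {R : realType}.

(** Reduces directional derivatives to one variable. The restriction w to the
    line is a separate argument so that it can be given in simplified form. *)
Lemma is_derive_line (v : R * R -> R) (x e : R * R) (w : R -> R) (d : R) :
  (forall h, v (h *: e + x) = w h) ->
  is_derive (0 : R) (1 : R) w d -> is_derive x e v d.
Proof.
move=> vw.
have E : (fun h : R => h^-1 *: ((v \o shift x) (h *: e) - v x)) =
   (fun h : R => h^-1 *: ((w \o shift 0) (h *: (1 : R)) - w 0)).
  apply/funext => h /=.
  by rewrite vw -(vw 0) scale0r add0r addr0 [h *: 1]mulr1.
case=> dv vd; split; first by rewrite /derivable E.
by rewrite /derive E.
Qed.

End PartialDerivatives.

Definition sqdist (R : realType) (p x : R * R) : R :=
  (x.1 - p.1) ^+ 2 + (x.2 - p.2) ^+ 2.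

Section RadialSolution.
Context {R : realType}.
Variables (p : R * R) (c : R).

Lemma continuous_sqdist : continuous (sqdist p).
Proof.
have c1 : continuous (fun x : R * R => x.1 - p.1).
  by move=> x; apply: cvgB; [exact: cvg_fst|exact: cvg_cst].
have c2 : continuous (fun x : R * R => x.2 - p.2).
  by move=> x; apply: cvgB; [exact: cvg_snd|exact: cvg_cst].
move=> x; apply: cvgD; rewrite expr2; apply: cvgM.
- exact: c1.
- exact: c1.
- exact: c2.
- exact: c2.
Qed.

Local Notation B m := (fun x : R * R => bessel_fun c m (sqdist p x)).

Lemma continuous_radial m : continuous (B m).
Proof.
move=> x; apply: continuous_comp; first exact: continuous_sqdist.
exact: continuous_bessel.
Qed.

Lemma is_derive_sqr (a b : R) :
  is_derive (0 : R) (1 : R) (fun h => (h + a) ^+ 2 + b) (2 * a).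
Proof.
rewrite (_ : (fun h => _) = (id + cst a : R -> R) ^+ 2 + cst b :> (R -> R))//.
apply: is_derive_eq.
have -> : (id + cst a : R -> R) 0 = a by rewrite -[LHS]/(0 + a) add0r.
by rewrite !addr0 expr1 /GRing.scale /= mulr1.
Qed.

Lemma is_derive_radial1 m (x : R * R) :
  is_derive x (e1 R) (B m) (2 * (x.1 - p.1) * B m.+1 x).
Proof.
have -> : 2 * (x.1 - p.1) * B m.+1 x =
    bessel_fun c m.+1 ((0 + (x.1 - p.1)) ^+ 2 + (x.2 - p.2) ^+ 2) *
    (2 * (x.1 - p.1)) by rewrite add0r mulrC.
have H := is_derive1_comp (is_derive_bessel c m _)
  (is_derive_sqr (x.1 - p.1) ((x.2 - p.2) ^+ 2)).
apply: (is_derive_line _ H) => h.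
rewrite /sqdist /= /GRing.scale /= mulr1 mulr0 add0r.
by rewrite addrA.
Qed.

Lemma is_derive_radial2 m (x : R * R) :
  is_derive x (e2 R) (B m) (2 * (x.2 - p.2) * B m.+1 x).
Proof.
have -> : 2 * (x.2 - p.2) * B m.+1 x =
    bessel_fun c m.+1 ((0 + (x.2 - p.2)) ^+ 2 + (x.1 - p.1) ^+ 2) *
    (2 * (x.2 - p.2)) by rewrite add0r [X in bessel_fun c _ X]addrC mulrC.
have H := is_derive1_comp (is_derive_bessel c m _)
  (is_derive_sqr (x.2 - p.2) ((x.1 - p.1) ^+ 2)).
apply: (is_derive_line _ H) => h.
rewrite /sqdist /= /GRing.scale /= mulr1 mulr0 add0r.
by rewrite addrC addrA.
Qed.

Lemma is_derive_coord (x : R * R) :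
  [/\ is_derive x (e1 R) (fun y : R * R => 2 * (y.1 - p.1)) 2,
     is_derive x (e2 R) (fun y : R * R => 2 * (y.1 - p.1)) 0,
     is_derive x (e1 R) (fun y : R * R => 2 * (y.2 - p.2)) 0 &
     is_derive x (e2 R) (fun y : R * R => 2 * (y.2 - p.2)) 2].
Proof.
have lin (a b : R) : is_derive (0 : R) (1 : R) (fun h : R => 2 * (h * a + b)) (2 * a).
  rewrite (_ : (fun h : R => _) = 2 *: (a *: (id : R -> R) + cst b)).
    by apply: is_derive_eq; rewrite addr0 /GRing.scale /= mulr1.
  by apply/funext => h; rewrite [h * a]mulrC.
have [i j] : (forall b, is_derive (0 : R) (1 : R) (fun h : R => 2 * (h * 1 + b)) 2)
  /\ (forall b, is_derive (0 : R) (1 : R) (fun h : R => 2 * (h * 0 + b)) 0).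
  by split=> b; have := lin _ b; [move/(_ 1)|move/(_ 0)]; rewrite ?mulr1 ?mulr0.
split.
- by apply: (is_derive_line _ (i (x.1 - p.1))) => h; rewrite /= addrA.
- by apply: (is_derive_line _ (j (x.1 - p.1))) => h; rewrite /= addrA.
- by apply: (is_derive_line _ (j (x.2 - p.2))) => h; rewrite /= addrA.
- by apply: (is_derive_line _ (i (x.2 - p.2))) => h; rewrite /= addrA.
Qed.

Lemma continuous_coord :
  continuous (fun y : R * R => 2 * (y.1 - p.1)) /\
  continuous (fun y : R * R => 2 * (y.2 - p.2)).
Proof.
split=> x; apply: cvgMr; apply: cvgB; first exact: cvg_fst.
- exact: cvg_cst.
- exact: cvg_snd.
- exact: cvg_cst.
Qed.

Lemma pd1_radial m : pd1 (B m) = fun x => 2 * (x.1 - p.1) * B m.+1 x.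
Proof. by apply/funext => x; have [] := is_derive_radial1 m x. Qed.

Lemma pd2_radial m : pd2 (B m) = fun x => 2 * (x.2 - p.2) * B m.+1 x.
Proof. by apply/funext => x; have [] := is_derive_radial2 m x. Qed.

Let is_derive_mul (f g : R * R -> R) (x e : R * R) (df dg : R) :
  is_derive x e f df -> is_derive x e g dg ->
  is_derive x e (fun y => f y * g y) (f x * dg + g x * df).
Proof. by move=> Hf Hg; exact: is_deriveM. Qed.

Lemma is_derive_grad m (x : R * R) :
  [/\ is_derive x (e1 R) (fun y : R * R => 2 * (y.1 - p.1) * B m y)
       (2 * (x.1 - p.1) * (2 * (x.1 - p.1) * B m.+1 x) + B m x * 2),
     is_derive x (e2 R) (fun y : R * R => 2 * (y.1 - p.1) * B m y)
       (2 * (x.1 - p.1) * (2 * (x.2 - p.2) * B m.+1 x) + B m x * 0),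
     is_derive x (e1 R) (fun y : R * R => 2 * (y.2 - p.2) * B m y)
       (2 * (x.2 - p.2) * (2 * (x.1 - p.1) * B m.+1 x) + B m x * 0) &
     is_derive x (e2 R) (fun y : R * R => 2 * (y.2 - p.2) * B m y)
       (2 * (x.2 - p.2) * (2 * (x.2 - p.2) * B m.+1 x) + B m x * 2)].
Proof.
have [c11 c12 c21 c22] := is_derive_coord x.
split; apply: is_derive_mul => //;
  solve [exact: is_derive_radial1 | exact: is_derive_radial2].
Qed.

Let pdE (f g1 g2 : R * R -> R) :
  (forall x, is_derive x (e1 R) f (g1 x)) ->
  (forall x, is_derive x (e2 R) f (g2 x)) -> pd1 f = g1 /\ pd2 f = g2.
Proof.
by move=> h1 h2; split; apply/funext => x; [have [] := h1 x|have [] := h2 x].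
Qed.

Let C1_onT (U : set (R * R)) (f g1 g2 : R * R -> R) :
  (forall x, is_derive x (e1 R) f (g1 x)) ->
  (forall x, is_derive x (e2 R) f (g2 x)) ->
  continuous g1 -> continuous g2 -> C1_on U f.
Proof.
move=> h1 h2 c1 c2 x _; have [-> ->] := pdE h1 h2.
by split; [have [] := h1 x|have [] := h2 x|exact: c1|exact: c2].
Qed.

Let continuous_grad m :
  continuous (fun x : R * R => 2 * (x.1 - p.1) * B m x) /\
  continuous (fun x : R * R => 2 * (x.2 - p.2) * B m x).
Proof.
have [c1 c2] := continuous_coord.
by split=> x; apply: cvgM; solve [exact: c1|exact: c2|exact: continuous_radial].
Qed.

Let continuous_hess m (a b : R * R -> R) (k : R) :
  continuous a -> continuous b ->
  continuous (fun x : R * R => a x * (b x * B m.+1 x) + B m x * k).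
Proof.
move=> ca cb x; apply: cvgD.
  by apply: cvgM; [exact: ca|apply: cvgM; [exact: cb|exact: continuous_radial]].
by apply: cvgM; [exact: continuous_radial|exact: cvg_cst].
Qed.

Lemma C2_radial (U : set (R * R)) : C2_on U (B 0).
Proof.
have [c1 c2] := continuous_coord.
split.
- apply: C1_onT => [x|x||]; first exact: is_derive_radial1.
  + exact: is_derive_radial2.
  + exact: (continuous_grad 1).1.
  + exact: (continuous_grad 1).2.
- rewrite pd1_radial; apply: C1_onT => [x|x||].
  + by have [h _ _ _] := is_derive_grad 1 x; exact: h.
  + by have [_ h _ _] := is_derive_grad 1 x; exact: h.
  + exact: continuous_hess.
  + exact: continuous_hess.
- rewrite pd2_radial; apply: C1_onT => [x|x||].
  + by have [_ _ h _] := is_derive_grad 1 x; exact: h.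
  + by have [_ _ _ h] := is_derive_grad 1 x; exact: h.
  + exact: continuous_hess.
  + exact: continuous_hess.
Qed.

(** In the plane the Laplacian of J(s) is 4 (s J'' + J'), a multiple of J by
    Bessel's equation. *)
Lemma laplacian_radial (x : R * R) : laplacian (B 0) x = 4 * c * B 0 x.
Proof.
rewrite /laplacian pd1_radial pd2_radial.
have [d1 _ _ d2] := is_derive_grad 1 x.
rewrite /pd1 /pd2; have [_ ->] := d1; have [_ ->] := d2.
rewrite -[RHS]mulrA -(bessel_ode c (sqdist p x)).
move: (bessel_fun c 1 _) (bessel_fun c 2 _) => b1 b2.
by rewrite /sqdist; ring.
Qed.

End RadialSolution.

Lemma mod_helmholtz_radial (R : realType) (mu : R) (p : R * R)
    (U : set (R * R)) :
  mod_helmholtz mu U (fun x => bessel_fun (mu ^+ 2 / 4) 0 (sqdist p x)).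
Proof.
split; first exact: C2_radial.
move=> x _; rewrite laplacian_radial.
by move: (bessel_fun _ _ _) => b; field.
Qed.

(** * Open sets of the plane and the area *)

Section OpenPlane.
Context {R : realType}.
Local Notation plane := (measurableTypeR R * measurableTypeR R)%type.

(** The measurable sets of the plane are generated by products of measurable
    sets, not by open sets; an open set is the union of the countably many
    rational squares that it contains. *)
Lemma open_plane_measurable (U : set (R * R)) :
  open U -> measurable (U : set plane).
Proof.
move=> oU.
pose box (q : rat * rat * nat) : set (R * R) :=
  ball (ratr q.1.1 : R) (q.2.+1%:R^-1) `*` ball (ratr q.1.2 : R) (q.2.+1%:R^-1).
rewrite (_ : U = \bigcup_(q in [set q | box q `<=` U]) box q); last first.
  apply/seteqP; split=> [x Ux|x [q qU]]; last exact: qU.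
  have /nbhs_ballP[e /= e0 eU] : nbhs x U by exact: open_nbhs_nbhs.
  have e20 : 0 < e / 2 by rewrite divr_gt0.
  have [n _ /(_ _ (leqnn n))/= ne] := near_infty_natSinv_lt (PosNum e20).
  set d := n.+1%:R^-1 in ne.
  have d0 : 0 < d by rewrite invr_gt0.
  have near_rat (t : R) : exists a : rat, ball t d (ratr a : R).
    have t0 : ball t d !=set0 by exists t; exact: ballxx.
    by have [s [td [a _ sE]]] := dense_rat t0 (ball_open t d); exists a; rewrite sE.
  have [[a xa] [b xb]] := (near_rat x.1, near_rat x.2).
  exists (a, b, n); last by split; exact: ball_sym.
  have dde t : ball t (d + d) `<=` ball t e.
    by apply: le_ball; rewrite [leRHS]splitr lerD// ltW.
  by move=> y [ya yb]; apply: eU; split; apply: dde; apply: ball_triangle; eauto.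
rewrite bigcup_mkcond; apply: countable_bigcupT_measurable => //= q.
by case: ifPn => // _; apply: measurableX; exact: measurable_ball.
Qed.

Lemma open_null_eq0 (U : set (R * R)) :
  open U -> area R U = 0%E -> U = set0.
Proof.
move=> oU U0; apply/seteqP; split=> // x Ux.
have /nbhs_ballP[e /= e0 eU] : nbhs x U by exact: open_nbhs_nbhs.
suff : (0 < area R U)%E by rewrite U0 ltxx.
apply: (@lt_le_trans _ _ (area R (ball x.1 e `*` ball x.2 e))).
  rewrite /area product_measure1E; [|exact: measurable_ball..].
  by rewrite /= !lebesgue_measure_ball ?ltW// -EFinM lte_fin mulr_gt0// mulrn_wgt0.
apply: le_measure; rewrite ?inE.
- by apply: measurableX; exact: measurable_ball.
- exact: open_plane_measurable.
- by move=> y [y1 y2]; exact: eU.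
Qed.

End OpenPlane.

(** * Area of discs and radial integrals *)

Section DiscArea.
Context {R : realType}.
Local Notation leb := (@lebesgue_measure R).
Local Notation plane := (measurableTypeR R * measurableTypeR R)%type.

(** The usual antiderivative of 2 sqrt (q^2 - t^2), with asin (t / q) replaced by
    2 atan (t / (q + sqrt (q^2 - t^2))) so that continuity at the end points of
    [-q, q] is immediate. *)
Definition halfdisc_prim (q t : R) : R :=
  t * Num.sqrt (q ^+ 2 - t ^+ 2)
  + 2 * q ^+ 2 * atan (t / (q + Num.sqrt (q ^+ 2 - t ^+ 2))).

Lemma continuous_sqrt_circle (q : R) :
  continuous (fun t : R => Num.sqrt (q ^+ 2 - t ^+ 2)).
Proof.
move=> t; apply: continuous_comp; last exact: sqrt_continuous.
by apply: cvgB; [exact: cvg_cst|exact: exprn_continuous].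
Qed.

Lemma continuous_halfdisc_prim (q : R) : 0 < q -> continuous (halfdisc_prim q).
Proof.
move=> q0 t; apply: cvgD.
  by apply: cvgM; [exact: cvg_id|exact: continuous_sqrt_circle].
apply: cvgMr.
apply: continuous_comp; last exact: continuous_atan.
apply: cvgM; first exact: cvg_id.
apply: cvgV; first by rewrite gt_eqF// ltr_wpDr ?sqrtr_ge0.
by apply: cvgD; [exact: cvg_cst|exact: continuous_sqrt_circle].
Qed.

Lemma is_derive_halfdisc_prim (q t : R) : 0 < q -> t ^+ 2 < q ^+ 2 ->
  is_derive t (1 : R) (halfdisc_prim q) (2 * Num.sqrt (q ^+ 2 - t ^+ 2)).
Proof.
move=> q0 tq.
have w20 : 0 < q ^+ 2 - t ^+ 2 by rewrite subr_gt0.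
set w := fun s : R => Num.sqrt (q ^+ 2 - s ^+ 2).
have w0 : 0 < w t by rewrite sqrtr_gt0.
have dw : is_derive t (1 : R) w (- (t / w t)).
  have dsq : is_derive t (1 : R) (fun s : R => q ^+ 2 - s ^+ 2) (- (2 * t)).
    by apply: is_derive_eq; rewrite [t *: 1]mulr1 add0r mul1r mulr_natl mulr2n.
  have H := @is_derive1_comp _ Num.sqrt _ t _ _ (is_derive1_sqrt w20) dsq.
  apply: (is_derive_eq H).
  by rewrite -/(w t); field; rewrite gt_eqF.
have qw0 : 0 < q + w t by rewrite addr_gt0.
have dinv : is_derive t (1 : R) (fun s => (q + w s)^-1)
    (- (q + w t) ^- 2 * - (t / w t)).
  have dqw : is_derive t (1 : R) (fun s => q + w s) (- (t / w t)).
    by apply: (is_derive_eq (is_deriveD (is_derive_cst q t 1) dw)); rewrite add0r.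
  by apply: is_deriveV; rewrite gt_eqF.
have du : is_derive t (1 : R) (fun s => s / (q + w s))
    (t * (- (q + w t) ^- 2 * - (t / w t)) + (q + w t)^-1 * 1).
  exact: is_deriveM.
have dat := @is_derive1_comp _ atan _ t _ _ (is_derive1_atan _) du.
have dtw : is_derive t (1 : R) (fun s => s * w s) (t * - (t / w t) + w t * 1).
  exact: is_deriveM.
have dZ := is_deriveZ (2 * q ^+ 2) dat.
apply: (is_derive_eq (is_deriveD dtw dZ)).
have wE : w t ^+ 2 = q ^+ 2 - t ^+ 2 by rewrite sqr_sqrtr// ltW.
rewrite -/(w t); move: (w t) w0 qw0 wE => W W0 qW0 WE.
have tE : t ^+ 2 = q ^+ 2 - W ^+ 2 by rewrite WE; ring.
(* With W = sqrt (q^2 - t^2), the factor 1 + u^2 of atan' simplifies. *)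
have s0 : 1 + (t / (q + W)) ^+ 2 = 2 * q / (q + W).
  rewrite exprMn tE exprVn.
  by field; rewrite gt_eqF.
rewrite s0 /GRing.scale /=.
have -> : t * (- (q + W) ^- 2 * - (t / W)) = t ^+ 2 * (q + W) ^- 2 / W by ring.
have -> : t * - (t / W) = - (t ^+ 2 / W) by ring.
rewrite tE; field.
by rewrite !gt_eqF.
Qed.

Lemma halfdisc_area (a q : R) : 0 < q ->
  (\int[leb]_(t in `[(a - q)%R, (a + q)%R])
     (2 * Num.sqrt (q ^+ 2 - (t - a) ^+ 2))%R%:E = (pi * q ^+ 2)%R%:E)%E.
Proof.
move=> q0.
have dF t : a - q < t -> t < a + q ->
    is_derive t (1 : R) (fun s => halfdisc_prim q (s - a))
      (2 * Num.sqrt (q ^+ 2 - (t - a) ^+ 2)).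
  move=> t1 t2.
  have ta : (t - a) ^+ 2 < q ^+ 2.
    by rewrite -subr_gt0 subr_sqr; apply: mulr_gt0; lra.
  have dta : is_derive t (1 : R) (fun s => s - a) 1.
    by apply: is_derive_eq; rewrite subr0.
  have H := @is_derive1_comp _ (halfdisc_prim q) _ t _ _
    (is_derive_halfdisc_prim q0 ta) dta.
  by apply: (is_derive_eq H); rewrite mulr1.
have cF : continuous (fun s => halfdisc_prim q (s - a)).
  move=> t; apply: (@continuous_comp _ _ _ (fun s => s - a)
    (halfdisc_prim q)); last exact: continuous_halfdisc_prim.
  by apply: cvgB; [exact: cvg_id|exact: cvg_cst].
rewrite (@continuous_FTC2 _ _ (fun s => halfdisc_prim q (s - a))).
- rewrite -EFinB; congr (_%:E); rewrite /halfdisc_prim.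
  have -> : a + q - a = q by ring.
  have -> : a - q - a = - q by ring.
  rewrite sqrrN subrr sqrtr0.
  have qq : q / q = 1 by rewrite divff// gt_eqF.
  by rewrite !mulr0 addr0 mulNr qq atanN atan1; field.
- by rewrite ltrD2l -subr_gt0 opprK addr_gt0.
- apply: continuous_subspaceT => t; apply: cvgMr.
  apply: (@continuous_comp _ _ _ (fun s => s - a)
    (fun s => Num.sqrt (q ^+ 2 - s ^+ 2))); last exact: continuous_sqrt_circle.
  by apply: cvgB; [exact: cvg_id|exact: cvg_cst].
- split.
  + move=> t /=; rewrite in_itv/= => /andP[t1 t2].
    by have [] := dF t t1 t2.
  + by apply: cvg_at_right_filter; exact: cF.
  + by apply: cvg_at_left_filter; exact: cF.
- move=> t; rewrite in_itv/= => /andP[t1 t2].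
  by rewrite derive1E; have [_ ->] := dF t t1 t2.
Qed.

Lemma measurable_sqdist (p : R * R) :
  measurable_fun [set: plane] (sqdist p : plane -> measurableTypeR R).
Proof.
apply: measurable_funD; apply: measurable_funX; apply: measurable_funB => //.
Qed.

Lemma sqdist_ge0 (p y : R * R) : 0 <= sqdist p y.
Proof. by rewrite addr_ge0 ?sqr_ge0. Qed.

Lemma measurable_sqdist_le (p : R * R) (b : R) :
  measurable ([set y | sqdist p y <= b] : set plane).
Proof.
rewrite (_ : [set y | _] = sqdist p @^-1` `]-oo, b]).
  by rewrite -[X in measurable X]setTI; apply: measurable_sqdist.
by apply/seteqP; split => y /=; rewrite in_itv.
Qed.

(** When the vertical line misses the disc, the radicand is negative and the
    square root is 0, so one formula covers all lines. *)
Lemma closed_disc_section (p : R * R) (b x : R) :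
  leb (xsection ([set y | sqdist p y <= b] : set plane) x) =
  (2 * Num.sqrt (b - (x - p.1) ^+ 2))%:E.
Proof.
have [bx|bx] := ltP b ((x - p.1) ^+ 2).
  rewrite (_ : xsection _ _ = set0).
    by rewrite measure0 ltr0_sqrtr ?mulr0// subr_lt0.
  rewrite -subset0 => y; rewrite /xsection/= inE /sqdist /= => h.
  suff /(le_lt_trans h) : b < (x - p.1) ^+ 2 + (y - p.2) ^+ 2 by rewrite ltxx.
  by rewrite (lt_le_trans bx)// lerDl sqr_ge0.
have bx0 : 0 <= b - (x - p.1) ^+ 2 by rewrite subr_ge0.
set w := Num.sqrt _.
have w0 : 0 <= w by exact: sqrtr_ge0.
rewrite (_ : xsection _ _ = `[p.2 - w, p.2 + w]%classic).
  rewrite lebesgue_measure_itv /= lte_fin; case: ifPn => [_|].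
    by rewrite -EFinB; congr (_%:E); ring.
  by rewrite -leNgt => ww; congr (_%:E); lra.
apply/seteqP; split => y; rewrite /xsection/= inE /sqdist /= in_itv /=.
  rewrite addrC -lerBrDr -ler_sqrt// sqrtr_sqr -/w ler_norml; lra.
move=> /andP[y1 y2]; rewrite addrC -lerBrDr -ler_sqrt// sqrtr_sqr -/w ler_norml.
lra.
Qed.

Lemma closed_disc_area (p : R * R) (b : R) :
  area R [set y | sqdist p y <= b] = (pi * Num.max 0 b)%:E.
Proof.
rewrite /area /product_measure1.
under eq_integral do rewrite /= closed_disc_section.
have [b0|b0] := leP b 0.
  rewrite mulr0 integral0_eq// => x _.
  by rewrite ler0_sqrtr ?mulr0// subr_le0 (le_trans b0)// sqr_ge0.
pose q := Num.sqrt b.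
have qb : q ^+ 2 = b by rewrite sqr_sqrtr// ltW.
have q0 : 0 < q by rewrite sqrtr_gt0.
rewrite -qb -(halfdisc_area p.1 q0) [RHS]integral_mkcond.
apply: eq_integral => x _; rewrite patchE; case: ifPn => //.
rewrite notin_setE /= in_itv /= => nx.
rewrite ler0_sqrtr ?mulr0// subr_le0 -ler_sqrt ?sqr_ge0//.
rewrite !sqrtr_sqr (ger0_norm (ltW q0)) leNgt ltr_norml; apply/negP => h.
by apply: nx; apply/andP; split; lra.
Qed.

Lemma area_sqdist_preimage_itv (p : R * R) (a b : R) : a <= b ->
  area R (sqdist p @^-1` `]a, b]) = (pi * (Num.max 0 b - Num.max 0 a))%:E.
Proof.
move=> ab.
rewrite (_ : _ @^-1` _ = [set y | sqdist p y <= b] `\` [set y | sqdist p y <= a]).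
  transitivity (area R [set y | (sqdist p y <= b)%R]
                - area R [set y | (sqdist p y <= a)%R])%E.
    rewrite /area measureD; [|exact: measurable_sqdist_le..|].
      by rewrite setIidr// => y /= /le_trans; apply.
    by have := closed_disc_area p b; rewrite /area /= => ->; rewrite ltry.
  by rewrite !closed_disc_area -EFinB mulrBr.
apply/seteqP; split => y /=; rewrite in_itv /=.
  by move=> /andP[h ->]; split => //; apply/negP; rewrite -ltNge.
by move=> [-> /negP]; rewrite -ltNge => ->.
Qed.

(** Polar coordinates, in the form needed for radial integrands. The measures
    agree on intervals by the area of discs. Uniqueness of the Lebesgue measure
    concerns the whole line, whence the auxiliary measure that completes the
    image of the area, divided by pi, by the length on the negative half line. *)
Lemma area_sqdist_preimage (p : R * R) (A : set (measurableTypeR R)) :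
  measurable A -> A `<=` `]0, +oo[ ->
  area R (sqdist p @^-1` A) = (pi%:E * leb A)%E.
Proof.
move=> mA A0.
have ipi0 : 0 <= (pi : R)^-1 by rewrite invr_ge0 pi_ge0.
have mD : measurable (`]-oo, 0]%classic : set (measurableTypeR R)) by [].
have pi0 : pi != 0 :> R by rewrite gt_eqF// pi_gt0.
have [nu nuE] : exists nu : {measure set (measurableTypeR R) -> \bar R},
    forall B, nu B = area R (sqdist p @^-1` B).
  unshelve eexists (pushforward (area R) (sqdist p : plane -> measurableTypeR R)).
    exact: measurable_sqdist.
  by [].
pose m := measure_add (mscale (NngNum ipi0) nu) (mrestr leb mD).
have mE B : m B = (pi^-1%:E * area R (sqdist p @^-1` B)
                   + leb (B `&` `]-oo, 0%R]))%E.
  by rewrite -nuE; exact: measure_addE.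
have leb_eqm : leb A = m A.
  apply: lebesgue_measure_unique => // _ /ocitvP[->|[[a b] /= ab ->]].
    by rewrite !measure0.
  rewrite [RHS]mE area_sqdist_preimage_itv ?ltW//=.
  rewrite (_ : `]a, b] `&` `]-oo, 0] = `]Num.min 0 a, Num.min 0 b]%classic).
    rewrite !lebesgue_measure_itv /= !lte_fin ab -EFinM mulrA mulVf// mul1r.
    have -> : (if Num.min 0 a < Num.min 0 b
        then ((Num.min 0 b)%:E - (Num.min 0 a)%:E)%E else 0%E)
        = (Num.min 0 b - Num.min 0 a)%:E.
      have mab : Num.min 0 a <= Num.min 0 b.
        by rewrite le_min !ge_min lexx (ltW ab) orbT.
      case: ltgtP mab => // -> _; by rewrite subrr.
    by rewrite -EFinB -EFinD; congr (_%:E); rewrite !maxEle !minEle;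
      do 2 case: ifP => _; lra.
  apply/seteqP; split => x /=; rewrite !in_itv /= gt_min le_min.
    by move=> [/andP[-> ->] ->]; rewrite orbT.
  move=> /andP[+ /andP[x0 ->]].
  by rewrite ltNge x0 /= => ->.
rewrite leb_eqm mE.
rewrite (_ : A `&` _ = set0) ?measure0 ?adde0.
  by rewrite muleA -EFinM divff// mul1e.
rewrite -subset0 => x [/A0]; rewrite /= !in_itv /= andbT => x0.
by rewrite leNgt x0.
Qed.

End DiscArea.

Section RadialIntegral.
Context {R : realType}.
Local Notation leb := (@lebesgue_measure R).
Local Notation plane := (measurableTypeR R * measurableTypeR R)%type.

Lemma integral_radial (p : R * R) (D : set R) (g : R -> R) :
  measurable (D : set (measurableTypeR R)) -> D `<=` `]0, +oo[ ->
  measurable_fun D g -> (forall s, D s -> 0 <= g s) ->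
  (\int[area R]_(y in sqdist p @^-1` D) (g (sqdist p y))%:E =
   pi%:E * \int[leb]_(s in D) (g s)%:E)%E.
Proof.
move=> mD D0 mg g0.
rewrite -(@ge0_integral_pushforward _ _ plane (measurableTypeR R) R
  (sqdist p) (measurable_sqdist p) (leb \x leb)%E D (fun s => (g s)%:E)) //; last 2 first.
- exact/measurable_EFinP.
- by move=> s; rewrite inE => /g0; rewrite lee_fin.
rewrite -(@ge0_integral_mscale _ _ R leb D mD (NngNum (pi_ge0 R))); last 2 first.
- exact/measurable_EFinP.
- by move=> s /g0; rewrite lee_fin.
apply: eq_measure_integral => [|mf A mA AD]; first exact: measurable_sqdist.
exact: (area_sqdist_preimage p mA (subset_trans AD D0)).
Qed.

(** * The logarithmic integral of the Bessel function *)

Section BesselLog.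
Variables (c b : R).
Hypotheses (c0 : 0 < c) (b0 : 0 < b).

(** The integrand v(y) log (r / |x0 - y|) as a function of s = |x0 - y|^2, with
    b = r^2; the factor 1 / 2 undoes the squaring inside the logarithm. *)
Definition bessel_log (s : R) : R := bessel_fun c 0 s * (ln (b / s) / 2).

Definition bessel_log_prim (s : R) : R :=
  (s * bessel_fun c 1 s * ln (b / s) + bessel_fun c 0 s) / (2 * c).

Lemma is_derive_ln_div (s : R) : 0 < s ->
  is_derive s (1 : R) (fun t => ln (b / t)) (- s^-1).
Proof.
move=> s0.
have dinv : is_derive s (1 : R) (fun t => b / t) (b * (- s ^- 2)).
  have H := is_deriveV (lt0r_neq0 s0) (is_derive_id s (1 : R)).
  apply: (is_derive_eq (is_deriveZ b H)).
  by rewrite /GRing.scale /= mulr1.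
have bs : 0 < b / s by rewrite divr_gt0.
apply: (is_derive_eq (@is_derive1_comp _ (@ln R) _ s _ _ (is_derive1_ln bs) dinv)).
by field; rewrite !gt_eqF.
Qed.

(** The equation s J'' + J' = c J turns c J log into the derivative of
    s J' log plus J', the last term coming from the derivative of log. *)
Lemma is_derive_bessel_log_prim (s : R) : 0 < s ->
  is_derive s (1 : R) bessel_log_prim (bessel_log s).
Proof.
move=> s0.
have dl := is_derive_ln_div s0.
have d1 : is_derive s (1 : R) (fun t => t * bessel_fun c 1 t)
    (s * bessel_fun c 2 s + bessel_fun c 1 s * 1).
  exact: (is_deriveM (is_derive_id s (1 : R)) (is_derive_bessel c 1 s)).
have d2 := is_deriveM d1 dl.
have d3 := is_deriveD d2 (is_derive_bessel c 0 s).
have d4 := is_deriveZ ((2 * c)^-1) d3.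
rewrite (_ : bessel_log_prim = (2 * c)^-1 *: (((fun t => t * bessel_fun c 1 t)
    * (fun t => ln (b / t))) + bessel_fun c 0)); last first.
  by apply/funext => t; rewrite /bessel_log_prim mulrC.
apply: (is_derive_eq d4); rewrite mulr1 (bessel_ode c s) /bessel_log /GRing.scale /=.
move: (bessel_fun c 0 s) (bessel_fun c 1 s) (ln (b / s)) => x y z.
by field; rewrite !gt_eqF.
Qed.

Lemma continuous_bessel_log (s : R) : 0 < s -> {for s, continuous bessel_log}.
Proof.
move=> s0.
have cl : {for s, continuous (fun t : R => ln (b / t))}.
  apply/differentiable_continuous/derivable1_diffP.
  by have [] := is_derive_ln_div s0.
apply: cvgM; first exact: continuous_bessel.
by apply: cvgM; [exact: cl|exact: cvg_cst].
Qed.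

Lemma bessel_log_ge0 (s : R) : 0 < s <= b -> 0 <= bessel_log s.
Proof.
move=> /andP[s0 sb]; rewrite mulr_ge0 ?divr_ge0//.
  by apply: le_trans (bessel_ge1 (ltW c0) (ltW s0)).
by apply: ln_ge0; rewrite ler_pdivlMr// mul1r.
Qed.

(** By the convention ln x = 0 for x <= 0, which includes b / 0; the value at
    s = 0, the centre of the disc, is therefore harmless. *)
Lemma bessel_log_npos (s : R) : s <= 0 -> bessel_log s = 0.
Proof.
move=> s0; rewrite /bessel_log ln0 ?mul0r ?mulr0//.
by rewrite mulr_ge0_le0 ?invr_le0// ltW.
Qed.

Lemma measurable_bessel_log : measurable_fun [set: R] bessel_log.
Proof.
rewrite -set_itvNyy (@itv_bndbnd_setU _ _ _ (BRight 0))//.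
apply/measurable_funU => //; split.
- apply/measurable_restrictT => //=.
  rewrite (_ : _ \_ _ = cst 0)//; apply/funext => s; rewrite patchE.
  by case: ifPn => //; rewrite inE/= in_itv/= => s0; rewrite bessel_log_npos.
- apply: subspace_continuous_measurable_fun => //.
  rewrite continuous_open_subspace; last exact: interval_open.
  by move=> s; rewrite inE/= in_itv/= andbT; exact: continuous_bessel_log.
Qed.

Lemma integral_bessel_log_away (e : R) : 0 < e < b ->
  (\int[leb]_(s in `[e, b]) (bessel_log s)%:E =
   (bessel_log_prim b - bessel_log_prim e)%:E)%E.
Proof.
move=> /andP[e0 eb].
have dF s : e <= s -> derivable bessel_log_prim s 1.
  by move=> es; have [] := is_derive_bessel_log_prim (lt_le_trans e0 es).
have cF s : e <= s -> {for s, continuous bessel_log_prim}.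
  by move=> es; apply/differentiable_continuous/derivable1_diffP/dF.
rewrite (@continuous_FTC2 _ _ bessel_log_prim)//.
- apply: continuous_in_subspaceT => s; rewrite inE /= in_itv/= => /andP[es _].
  exact/continuous_bessel_log/(lt_le_trans e0).
- split.
  + by move=> s; rewrite in_itv/= => /andP[es _]; exact/dF/ltW.
  + by apply: cvg_at_right_filter; exact: cF.
  + by apply: cvg_at_left_filter; exact/cF/ltW.
- move=> s; rewrite in_itv/= => /andP[es _].
  by rewrite derive1E; have [_ ->] := is_derive_bessel_log_prim (lt_trans e0 es).
Qed.

(* The integrand is unbounded at 0, so [0, b] is exhausted by the intervals
   [cut n, b]. With the inverse square in the cut-off, the crude bound
   log (b / cut n) = 2 log (n + 2) <= 2 (n + 2) already shows that
   cut n * log (b / cut n) tends to 0. *)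
Let cut (n : nat) : R := b * n.+2%:R ^- 2.

Let cut_gt0 n : 0 < cut n.
Proof. by rewrite mulr_gt0 ?invr_gt0 ?exprn_gt0. Qed.

Let cut_lt n : cut n < b.
Proof.
rewrite -[ltRHS]mulr1 ltr_pM2l// invf_lt1 ?exprn_gt0//.
by rewrite exprn_egt1// ltr1n.
Qed.

Let cut_cvg0 : cut n @[n --> \oo] --> (0 : R).
Proof.
rewrite -[X in _ --> X](mulr0 b); apply: cvgMr.
rewrite -[X in _ --> X](mulr0 (0 : R)).
rewrite (_ : (fun n => _) = fun n => n.+2%:R^-1 * n.+2%:R^-1 :> R); last first.
  by apply/funext => n; rewrite -exprVn expr2.
have h : n.+2%:R^-1 @[n --> \oo] --> (0 : R).
  by rewrite (cvg_shiftS (fun n => n.+1%:R^-1 : R)); exact: cvg_harmonic.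
exact: cvgM.
Qed.

Let cut_log_cvg0 : cut n * ln (b / cut n) @[n --> \oo] --> (0 : R).
Proof.
apply: (@squeeze_cvgr _ _ _ _ (fun=> 0 : R) (fun n => 2 * b * n.+2%:R^-1)).
- apply/nearW => n.
  have -> : b / cut n = n.+2%:R ^+ 2.
    by rewrite /cut invfM invrK mulrA divff ?mul1r// gt_eqF.
  rewrite lnXn// mulr_ge0 ?(ltW (cut_gt0 n)) ?mulrn_wge0 ?ln_ge0 ?ler1n//=.
  rewrite (_ : 2 * b * n.+2%:R^-1 = cut n * (n.+2%:R *+ 2)).
    by rewrite ler_pM2l// lerMn2r ltW ?orbT// ln_sublinear.
  rewrite /cut; have := ltr0Sn R n.+1; move: (n.+2%:R) => N N0.
  by rewrite -mulr_natl; field; rewrite gt_eqF.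
- exact: cvg_cst.
- rewrite -[X in _ --> X](mulr0 (2 * b)); apply: cvgMr.
  by rewrite (cvg_shiftS (fun n => n.+1%:R^-1 : R)); exact: cvg_harmonic.
Qed.

Lemma integral_bessel_log :
  (\int[leb]_(s in `]0%R, b]) (bessel_log s)%:E =
   ((bessel_fun c 0 b - 1) / (2 * c))%:E)%E.
Proof.
have cupE : `]0, b]%classic = \bigcup_n `[cut n, b]%classic.
  apply/seteqP; split=> [s /=|s [n _] /=]; rewrite !in_itv/=.
    move=> /andP[s0 sb].
    have [n _ /(_ _ (leqnn n)) nP] := (cvgr0_norm_lt _ cut_cvg0 _ s0).
    exists n => //=; rewrite in_itv/= sb andbT.
    by move: nP => /=; rewrite gtr0_norm// => /ltW.
  by move=> /andP[ns ->]; rewrite andbT (lt_le_trans (cut_gt0 n)).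
have : (\int[leb]_(s in `[cut n, b]) (bessel_log s)%:E)%E @[n --> \oo] -->
    (\int[leb]_(s in `]0%R, b]) (bessel_log s)%:E)%E.
  rewrite cupE; apply: ge0_nondecreasing_set_cvg_integral => //.
  - move=> n m nm; apply/subsetPset => s /=; rewrite !in_itv/= => /andP[ns ->].
    rewrite andbT (le_trans _ ns)// ler_pM2l// lef_pV2 ?posrE ?exprn_gt0//.
    by rewrite lerXn2r ?nnegrE// ler_nat.
  - move=> n; apply/measurable_EFinP; apply: measurable_funTS.
    exact: measurable_bessel_log.
  - move=> n s /=; rewrite in_itv/= => /andP[ns sb].
    by rewrite lee_fin bessel_log_ge0// sb (lt_le_trans (cut_gt0 n)).
rewrite (_ : (fun n => _) = fun n => (bessel_log_prim b - bessel_log_prim (cut n))%:E); last first.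
  by apply/funext => n; rewrite integral_bessel_log_away// cut_gt0 cut_lt.
move=> h; apply: (cvg_unique _ h) => //.
apply: cvg_EFin; first by near=> n.
rewrite (_ : _ / _ = bessel_log_prim b - 1 / (2 * c)); last first.
  by rewrite /bessel_log_prim divff ?gt_eqF// ln1 mulr0 add0r mulrBl.
apply: cvgB; first exact: cvg_cst.
apply: cvgM; last exact: cvg_cst.
rewrite -[X in _ --> X]add0r; apply: cvgD.
  rewrite (_ : (fun n => _) = fun n => cut n * ln (b / cut n) * bessel_fun c 1 (cut n)).
    rewrite -[X in _ --> X](mul0r (bessel_fun c 1 0)); apply: cvgM => //.
    exact: (continuous_cvg _ (@continuous_bessel R c 1 0) cut_cvg0).
  by apply/funext => n; rewrite mulrAC.
rewrite -(bessel_fun0 c).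
exact: (continuous_cvg _ (@continuous_bessel R c 0 0) cut_cvg0).
Unshelve. all: by end_near.
Qed.

End BesselLog.
End RadialIntegral.

(** * Integrals and null sets *)

Section IntegralHelpers.
Context d (T : measurableType d) (R : realType).
Variable mu : {measure set T -> \bar R}.

Lemma integrable_disjointU (A B : set T) (f : T -> \bar R) :
  measurable A -> measurable B -> [disjoint A & B] ->
  mu.-integrable A f -> mu.-integrable B f -> mu.-integrable (A `|` B) f.
Proof.
move=> mA mB AB /integrableP[mfA fA] /integrableP[mfB fB].
have mf : measurable_fun (A `|` B) f by exact/measurable_funU.
apply/integrableP; split=> //.
rewrite ge0_integral_setU//; first exact: lte_add_pinfty.
exact: measurableT_comp.
Qed.

(** The set B where f is positive is kept apart from the domain A, on whose
    remainder f may vanish, as it does on the circle bounding a disc. *)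
Lemma Rintegral_eq0_null (A B : set T) (f : T -> R) :
  measurable A -> measurable B -> B `<=` A -> mu.-integrable A (EFin \o f) ->
  (forall x, A x -> 0 <= f x) -> (forall x, B x -> 0 < f x) ->
  \int[mu]_(x in A) f x = 0 -> mu B = 0%E.
Proof.
move=> mA mB BA intf f0 fB Rf0.
have /integrableP[mf _] := intf.
have If : (\int[mu]_(x in A) (f x)%:E = 0)%E.
  by rewrite -[LHS]fineK ?integrable_fin_num//; congr (_%:E).
have /(ae_eq_integral_abs mu mA) [+ _] := mf.
case=> [|N [mN N0 fN]].
  rewrite -{}If; apply: eq_integral => x /[!inE] Ax /=.
  by rewrite ger0_norm// f0.
apply: (subset_measure0 mB mN _ N0) => x Bx; apply: fN => /= /(_ (BA _ Bx)) [fx0].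
by have := fB _ Bx; rewrite fx0 ltxx.
Qed.

End IntegralHelpers.

(** * Euclidean discs *)

Section DiscGeometry.
Context {R : realType}.
Implicit Types (p x : R * R) (r : R).

Lemma dist2E p x : dist2 p x = Num.sqrt (sqdist p x).
Proof. by rewrite /dist2 /sqdist -sqrrN opprB -[in X in _ + X]sqrrN opprB. Qed.

Lemma sqdistC p x : sqdist p x = sqdist x p.
Proof. by rewrite /sqdist; ring. Qed.

Lemma sqdist_eq0 p x : sqdist p x = 0 -> x = p.
Proof.
move/eqP; rewrite paddr_eq0 ?sqr_ge0// !sqrf_eq0 !subr_eq0 => /andP[].
by case: x p => [x1 x2] [p1 p2] /= /eqP -> /eqP ->.
Qed.

Lemma discE p r : 0 < r -> disc p r = [set x | sqdist p x < r ^+ 2].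
Proof.
move=> r0; apply/seteqP; split => x; rewrite /disc /= dist2E sqdistC => h.
  by rewrite -ltr_sqrt ?exprn_gt0// sqrtr_sqr (ger0_norm (ltW r0)).
by rewrite -[ltRHS]ger0_norm ?ltW// -sqrtr_sqr ltr_sqrt ?exprn_gt0.
Qed.

Lemma open_disc p r : 0 < r -> open (disc p r).
Proof.
move=> r0; rewrite discE// (_ : [set x | _] = sqdist p @^-1` `]-oo, (r ^+ 2)[).
  by apply: open_comp; [move=> x _; exact: continuous_sqdist|exact: interval_open].
by apply/seteqP; split => x; rewrite /= in_itv.
Qed.

Lemma bounded_sqdist (A : set (R * R)) p : bounded_set A ->
  exists M, forall x, A x -> sqdist p x <= M.
Proof.
move=> [M0 [_ AM0]].
have [M AM] : exists M, forall x, A x -> `|x| <= M.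
  by exists (M0 + 1); apply: AM0; rewrite ltrDl.
exists ((M + `|p.1|) ^+ 2 + (M + `|p.2|) ^+ 2) => x Ax.
have /= := AM _ Ax; rewrite prod_normE ge_max => /andP[x1 x2].
have le_sqr (s q : R) : `|s| <= M -> (s - q) ^+ 2 <= (M + `|q|) ^+ 2.
  move=> sM; have Mge0 : 0 <= M by exact: le_trans sM.
  rewrite -[leLHS]real_normK ?num_real// lerXn2r ?nnegrE ?addr_ge0//.
  by rewrite (le_trans (ler_normB _ _))// lerD2r.
by apply: lerD; exact: le_sqr.
Qed.

(** From a point of the bounding circle one could move a little outwards along
    the radius without leaving the open set. *)
Lemma open_sub_closed_disc (U : set (R * R)) p r : 0 < r -> open U ->
  (forall x, U x -> sqdist p x <= r ^+ 2) -> U `<=` disc p r.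
Proof.
move=> r0 oU UD x Ux; rewrite discE//= lt_neqAle UD// andbT.
apply/negP => /eqP xr.
pose y (t : R) : R * R := (x.1 + t * (x.1 - p.1), x.2 + t * (x.2 - p.2)).
have yE t : sqdist p (y t) = (1 + t) ^+ 2 * r ^+ 2.
  by rewrite -xr /sqdist /=; ring.
have cy : y t @[t --> (0 : R)] --> x.
  have cyi (a b : R) : a + t * b @[t --> (0 : R)] --> a.
    rewrite -[X in _ --> X]addr0 -[X in _ --> a + X](mul0r b).
    by apply: cvgD; [exact: cvg_cst|apply: cvgM; [exact: cvg_id|exact: cvg_cst]].
  rewrite [x in _ --> x]surjective_pairing.
  exact: cvg_pair (cyi _ _) (cyi _ _).
have : \forall t \near (0 : R)^'+, U (y t).
  apply: (cvg_at_right_filter cy); exact: open_nbhs_nbhs.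
move=> nU.
have : \forall t \near (0 : R)^'+, False.
  near=> t.
  have t0 : 0 < t by near: t; exact: nbhs_right_gt.
  have /UD : U (y t) by near: t.
  rewrite yE leNgt => /negP; apply.
  by rewrite ltr_pMl ?exprn_gt0// exprn_egt1// ltrDl.
by move=> /filter_ex[].
Unshelve. all: by end_near. Qed.

End DiscGeometry.

(** * The weighted mean value identity on discs *)

Section RadialPotential.
Context {R : realType}.
Local Notation leb := (@lebesgue_measure R).
Local Notation plane := (measurableTypeR R * measurableTypeR R)%type.

(** The squared distance maps the disc to [0, b]; the centre, where it vanishes,
    can be left out because the integrand is 0 there. *)
Lemma integral_bessel_log_disc (p : R * R) (c b : R) : 0 < c -> 0 < b ->
  (\int[area R]_(y in [set y | (sqdist p y <= b)%R])
     (bessel_log c b (sqdist p y))%:E =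
   (pi * ((bessel_fun c 0 b - 1) / (2 * c)))%R%:E)%E.
Proof.
move=> c0 b0.
have D0 : (`]0, b]%classic : set R) `<=` `]0, +oo[.
  by move=> s /=; rewrite !in_itv/= andbT => /andP[].
have := @integral_radial R p `]0, b]%classic (bessel_log c b) (measurable_itv _) D0.
rewrite integral_bessel_log// -EFinM => <-; last 2 first.
- by apply: measurable_funTS; exact: measurable_bessel_log.
- by move=> s /=; rewrite in_itv/=; exact: bessel_log_ge0.
rewrite integral_mkcond [RHS]integral_mkcond; apply: eq_integral => y _.
rewrite !patchE; have [y0|y0] := leP (sqdist p y) 0.
  by rewrite bessel_log_npos//; do 2 case: ifP => _.
congr (if _ then _ else _); apply/idP/idP; rewrite !inE /= in_itv /= y0.
  by move=> ->.
by [].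
Qed.

Lemma measurable_bessel_log_sqdist (p : R * R) (c b : R) :
  0 < b -> measurable_fun [set: plane] (fun y => bessel_log c b (sqdist p y)).
Proof.
move=> b0.
apply: (@measurableT_comp _ _ _ plane (measurableTypeR R) R (bessel_log c b)).
  exact: measurable_bessel_log.
exact: measurable_sqdist.
Qed.

Lemma bessel_log_gt0 (c b s : R) : 0 < c -> 0 < s < b -> 0 < bessel_log c b s.
Proof.
move=> c0 /andP[s0 sb]; rewrite mulr_gt0 ?divr_gt0//.
  by rewrite (lt_le_trans _ (bessel_ge1 (ltW c0) (ltW s0))).
by apply: ln_gt0; rewrite ltr_pdivlMr// mul1r.
Qed.

Lemma bessel_log_lt0 (c b s : R) : 0 < c -> 0 < b -> b < s ->
  bessel_log c b s < 0.
Proof.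
move=> c0 b0 bs; have s0 := lt_trans b0 bs.
rewrite pmulr_rlt0; last first.
  by rewrite (lt_le_trans _ (bessel_ge1 (ltW c0) (ltW s0))).
by rewrite pmulr_llt0// ln_lt0// divr_gt0//= ltr_pdivrMr// mul1r.
Qed.

Lemma ln_dist2E (p y : R * R) (r : R) : 0 < r ->
  ln (r / dist2 p y) = ln (r ^+ 2 / sqdist p y) / 2.
Proof.
move=> r0; rewrite dist2E.
have := sqdist_ge0 p y; rewrite le_eqVlt => /predU1P[<-|s0].
  by rewrite sqrtr0 !invr0 !mulr0 ln0// mul0r.
have -> : r ^+ 2 / sqdist p y = (r / Num.sqrt (sqdist p y)) ^+ 2.
  by rewrite expr_div_n sqr_sqrtr// ltW.
rewrite lnXn; last by rewrite divr_gt0// sqrtr_gt0.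
by rewrite -[X in _ = X / _]mulr_natr mulfK.
Qed.

(** The only singularity is at s = 0, so boundedness away from it follows by
    compactness; this makes the integrand integrable on Omega outside the disc. *)
Lemma bounded_bessel_log (c b M : R) : 0 < b ->
  exists C, forall s, b <= s <= M -> `|bessel_log c b s| <= C.
Proof.
move=> b0; have [bM|Mb] := leP b M; last first.
  exists 0 => s /andP[bs sM]; have := le_trans bs sM.
  by rewrite leNgt Mb.
have cf : {within `[b, M], continuous (fun s => `|bessel_log c b s|)}.
  apply: continuous_in_subspaceT => s; rewrite inE /= in_itv/= => /andP[bs _].
  apply: cvg_norm; apply: continuous_bessel_log => //.
  exact: lt_le_trans bs.
have [t _ tmax] := EVT_max bM cf.
by exists (`|bessel_log c b t|) => s sM; apply: tmax; rewrite in_itv.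
Qed.

Lemma area_lt_pinfty (A : set (R * R)) (p : R * R) (M : R) :
  measurable (A : set plane) -> (forall x, A x -> sqdist p x <= M) ->
  (area R A < +oo)%E.
Proof.
move=> mA AM.
have := closed_disc_area p M; rewrite /area => DM.
apply: (@le_lt_trans _ _ ((leb \x leb) [set y | (sqdist p y <= M)%R])%E).
  by apply: le_measure; rewrite ?inE//; exact: measurable_sqdist_le.
by rewrite DM ltry.
Qed.

End RadialPotential.

(** * Rigidity of the disc *)

(* Without regularity of Omega, equality with the disc holds exactly up to a
   null set: a disc punctured at a point other than x0 satisfies every
   hypothesis. *)
Theorem theorem4 (R : realType) (Omega : set (R * R)) (r : R)
    (hOmega : bounded_domain Omega) (hr : 0 < r)
    (harea : ((pi * r ^+ 2)%:E <= area R Omega)%E)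
    (x0 : R * R) (hx0 : Omega x0) (mu : R) (hmu : 0 < mu)
    (hmean : forall v : R * R -> R,
      mod_helmholtz mu (disc_nbhd Omega r) v ->
      (forall y, disc_nbhd Omega r y -> 0 < v y) ->
      coef_a (mu * r) * v x0 =
        (fine (area R Omega))^-1 *
        \int[area R]_(y in Omega) (v y * ln (r / dist2 x0 y))) :
  [/\ Omega `<=` disc x0 r,
      area R (disc x0 r `\` Omega) = 0%E &
      regopen Omega -> Omega = disc x0 r].
Proof.
have [_ oO _ bO] := hOmega.
pose plane := (measurableTypeR R * measurableTypeR R)%type.
pose c := mu ^+ 2 / 4.
pose b := r ^+ 2.
have c0 : 0 < c by rewrite divr_gt0 ?exprn_gt0.
have b0 : 0 < b by rewrite exprn_gt0.
pose f (y : plane) := bessel_log c b (sqdist x0 y).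
pose a := coef_a (mu * r).
pose D : set plane := [set y | sqdist x0 y <= b].
have mO : measurable (Omega : set plane) := open_plane_measurable oO.
have mD : measurable D := measurable_sqdist_le x0 b.
have mf A : measurable_fun (A : set plane) f.
  by apply: measurable_funTS; exact: measurable_bessel_log_sqdist.
(* (J(r^2) - 1) / (2 c) with 2 c = mu^2 / 2 is the coefficient a times r^2. *)
have aE : pi * ((bessel_fun c 0 b - 1) / (2 * c)) = a * (pi * b).
  rewrite /a /coef_a besselI0E -/c -/b /c /b.
  move: (bessel_fun _ 0 _) => J; field.
  by rewrite !gt_eqF.
have a_gt0 : 0 < a.
  rewrite /a /coef_a besselI0E divr_gt0 ?exprn_gt0 ?mulr_gt0//.
  by rewrite subr_gt0 bessel_gt1.
have [M hM] := bounded_sqdist x0 bO.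
have areaO : (area R Omega < +oo)%E := area_lt_pinfty mO hM.
pose m := fine (area R Omega).
have mge : pi * b <= m by rewrite -lee_fin fineK// ge0_fin_numE.
have m_gt0 : 0 < m by rewrite (lt_le_trans _ mge)// mulr_gt0// pi_gt0.
have f_ge0 y : D y -> 0 <= f y.
  rewrite /D /= => yD; have [y0|y0] := leP (sqdist x0 y) 0.
    by rewrite /f bessel_log_npos.
  by apply: bessel_log_ge0; rewrite // y0.
have intDE : (\int[area R]_(y in D) (f y)%:E = (a * (pi * b))%:E)%E.
  by rewrite integral_bessel_log_disc// aE.
have intD : (area R).-integrable D (EFin \o f).
  apply/integrableP; split; first exact/measurable_EFinP.
  rewrite (eq_integral (fun y : plane => (f y)%:E)).
    by rewrite intDE ltry.
  by move=> y /[!inE] yD /=; rewrite ger0_norm// f_ge0.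
have mOD : measurable (Omega `\` D : set plane) by exact: measurableD.
have mOID : measurable (Omega `&` D : set plane) by exact: measurableI.
have mDO : measurable (D `\` Omega : set plane) by exact: measurableD.
have intOD : (area R).-integrable (Omega `\` D) (EFin \o f).
  apply: measurable_bounded_integrable => //.
    by apply: area_lt_pinfty mOD _ => x [/hM + _]; exact.
  have [C hC] := bounded_bessel_log c M b0.
  exists C; split; first exact: num_real.
  move=> t Ct y [Oy /negP]; rewrite -ltNge => yb.
  by apply: le_trans (ltW Ct); apply: hC; rewrite ltW//= hM.
have intOID : (area R).-integrable (Omega `&` D) (EFin \o f).
  by apply: integrableS intD => //; exact: subIsetr.
have intDO : (area R).-integrable (D `\` Omega) (EFin \o f).
  by apply: integrableS intD => //; exact: subDsetl.
have OE : Omega = (Omega `&` D) `|` (Omega `\` D) by rewrite setUIDK.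
have DE : D = (Omega `&` D) `|` (D `\` Omega) by rewrite setIC setUIDK.
have dO : [disjoint Omega `&` D & Omega `\` D].
  by apply/disj_setPS => y [[_ ?] [_]].
have dD : [disjoint Omega `&` D & D `\` Omega].
  by apply/disj_setPS => y [[? _] [_]].
have sumO : \int[area R]_(y in Omega) f y =
    \int[area R]_(y in Omega `&` D) f y + \int[area R]_(y in Omega `\` D) f y.
  by rewrite [in LHS]OE Rintegral_setU//; exact: integrable_disjointU.
have sumD : a * (pi * b) =
    \int[area R]_(y in Omega `&` D) f y + \int[area R]_(y in D `\` Omega) f y.
  rewrite -Rintegral_setU -?DE//.
  by rewrite /Rintegral intDE.
have mean : a * m = \int[area R]_(y in Omega) f y.
  have := hmean (fun y => bessel_fun c 0 (sqdist x0 y))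
    (mod_helmholtz_radial mu x0 _).
  have s0 : sqdist x0 x0 = 0 by rewrite /sqdist !subrr expr0n/= addr0.
  rewrite s0 bessel_fun0 mulr1 -/a -/m => ->; last first.
    by move=> y _; rewrite (lt_le_trans _ (bessel_ge1 (ltW c0) (sqdist_ge0 _ _))).
  rewrite mulrAC mulVf ?mul1r ?gt_eqF//.
  by apply: eq_Rintegral => y _; rewrite ln_dist2E.
pose g (y : plane) := -1 * f y.
have intg : (area R).-integrable (Omega `\` D) (EFin \o g).
  rewrite (_ : EFin \o g = fun y => ((-1)%:E * (EFin \o f) y)%E).
    exact: integrableZl.
  by apply/funext => y; rewrite /g /= EFinM.
have intgE : \int[area R]_(y in Omega `\` D) g y =
    - \int[area R]_(y in Omega `\` D) f y.
  by rewrite -mulN1r -RintegralZl.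
have g_gt0 y : (Omega `\` D) y -> 0 < g y.
  move=> [_ /negP]; rewrite -ltNge => yb.
  by rewrite /g mulN1r oppr_gt0; exact: bessel_log_lt0.
have out_le0 : \int[area R]_(y in Omega `\` D) f y <= 0.
  by rewrite -oppr_ge0 -intgE; apply: Rintegral_ge0 => y /g_gt0/ltW.
have in_ge0 : 0 <= \int[area R]_(y in D `\` Omega) f y.
  by apply: Rintegral_ge0 => y [Dy _]; exact: f_ge0.
have amb : a * (pi * b) <= a * m by rewrite ler_pM2l.
(* 0 <= a (m - pi r^2) = out - in, while out <= 0 <= in. *)
have [out0 in0] : \int[area R]_(y in Omega `\` D) f y = 0 /\
    \int[area R]_(y in D `\` Omega) f y = 0.
  move: out_le0 in_ge0 amb; rewrite mean sumO sumD lerD2l => X0 Y0 YX.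
  by split; apply/eqP; rewrite eq_le ?X0 ?Y0 ?(le_trans YX)// (le_trans Y0).
have OD0 : area R (Omega `\` D) = 0%E.
  apply: (Rintegral_eq0_null mOD mOD _ intg) => //.
  - by move=> y /g_gt0/ltW.
  - by rewrite intgE out0 oppr0.
have mB : measurable (disc x0 r : set plane).
  by apply: open_plane_measurable; exact: open_disc.
have DO0 : area R (disc x0 r `\` Omega) = 0%E.
  have mBO : measurable (disc x0 r `\` Omega : set plane) by exact: measurableD.
  apply: (Rintegral_eq0_null mDO mBO _ intDO _ _ in0).
  - by move=> y [+ nOy]; rewrite discE//= => /ltW.
  - by move=> y [/f_ge0].
  - move=> y [+ nOy]; rewrite discE//= => yb; apply: bessel_log_gt0 => //.
    rewrite yb andbT lt_neqAle sqdist_ge0 andbT; apply/eqP => y0.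
    by apply: nOy; rewrite (sqdist_eq0 (esym y0)).
have sOD : Omega `<=` disc x0 r.
  have oOD : open (Omega `\` D).
    rewrite (_ : _ `\` _ = Omega `&` sqdist x0 @^-1` `]b, +oo[).
      apply: openI => //; apply: open_comp; last exact: interval_open.
      by move=> y _; exact: continuous_sqdist.
    apply/seteqP; split => y [Oy /= h]; split => //.
      by rewrite in_itv/= andbT ltNge; apply/negP.
    by move: h; rewrite in_itv/= andbT ltNge => /negP.
  apply: open_sub_closed_disc => // y Oy; apply: contrapT => nDy.
  by have : (Omega `\` D) y by []; rewrite (open_null_eq0 oOD OD0).
split=> // regO; apply/seteqP; split=> //.
rewrite -regO -open_subsetE; last exact: open_disc.
have oE : open (disc x0 r `\` closure Omega).
  by apply: openI; [exact: open_disc|exact/closed_openC/closed_closure].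
move=> y Dy; apply: contrapT => nOy.
suff E0 : disc x0 r `\` closure Omega = set0.
  by have : (disc x0 r `\` closure Omega) y by []; rewrite E0.
apply: open_null_eq0 => //.
apply: (subset_measure0 _ _ _ DO0).
- exact: open_plane_measurable.
- exact: measurableD.
- by apply: setDS; exact: subset_closure.
Qed.
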